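(* Let $n,\delta\in\mathbb{N}$ with $\delta\geq 3$ and $n\geq 8$. If $G$ is a connected triangle-free graph of order $n$, minimum degree $\delta$ and diameter $d$, then \[\pi(G)\geq \frac{\delta(d-4)(d-1)}{8(n-1)}.\]
   Context: All graphs are finite and simple. For a connected graph $G$ of order $n\ge 2$ and a vertex $v$, $\overline{\sigma}(v)=\frac{1}{n-1}\sum_{w\in V(G)}d(v,w)$, where $d$ is the shortest-path distance, and the proximity is $\pi(G)=\min_{v\in V(G)}\overline{\sigma}(v)$. The diameter is the maximum distance between two vertices. Triangle-free means no $K_3$ subgraph. *)

(* Defs.v *)
From mathcomp Require Import all_boot all_order all_algebra.

Set Implicit Arguments.
Unset Strict Implicit.
Unset Printing Implicit Defensive.

Import Order.TTheory GRing.Theory Num.Theory.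
Local Open Scope ring_scope.

(* A finite simple graph is a symmetric irreflexive edge relation
   e : rel T on a finite vertex type T. *)

Definition connected (T : finType) (e : rel T) : Prop :=
  forall x y : T, connect e x y.

Definition triangle_free (T : finType) (e : rel T) : Prop :=
  forall x y z : T, ~~ [&& e x y, e y z & e x z].

Definition has_walk (T : finType) (e : rel T) (x y : T) (k : nat) : bool :=
  [exists p : k.-tuple T, path e x p && (last x p == y)].

(* Reachable vertices are joined by a walk of length < #|T|; if x and y lie
   in different components the value is the junk value #|T|. *)
Definition dist (T : finType) (e : rel T) (x y : T) : nat :=
  find (has_walk e x y) (iota 0 #|T|).

Definition diameter (T : finType) (e : rel T) : nat :=
  (\max_(x : T) \max_(y : T) dist e x y)%N.

Definition degree (T : finType) (e : rel T) (v : T) : nat := #|[set w | e v w]|.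

(* The order types used here have no top element, so the iteration starts from
   the first item of s; x0 is only returned for the empty sequence. *)
Definition seq_min (disp : Order.disp_t) (R : orderType disp) (x0 : R)
    (s : seq R) : R :=
  \big[Order.min/head x0 s]_(x <- s) x.

Definition min_degree (T : finType) (e : rel T) : nat :=
  seq_min 0%N [seq degree e v | v : T].

Definition avg_dist (T : finType) (e : rel T) (v : T) : rat :=
  (\sum_(w : T) (dist e v w)%:R) / (#|T|%:R - 1).

Definition proximity (T : finType) (e : rel T) : rat :=
  seq_min 0 [seq avg_dist e v | v : T].

Lemma dist_walk (T : finType) (e : rel T) (x y : T) :
  connect e x y -> has_walk e x y (dist e x y).
Proof.
case/connectP=> p0 /shortenP[p pP pU _ ->].
have hp : has_walk e x (last x p) (size p).
  by apply/existsP; exists (in_tuple p); rewrite pP eqxx.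
have lt_p : (size p < #|T|)%N.
  by rewrite -[(size p).+1]/(size (x :: p)) -(card_uniqP pU) max_card.
have hh : has (has_walk e x (last x p)) (iota 0 #|T|).
  by apply/hasP; exists (size p) => //; rewrite mem_iota.
by move: (nth_find 0%N hh); rewrite nth_iota // -[X in (_ < X)%N](size_iota 0) -has_find.
Qed.

Lemma dist_min (T : finType) (e : rel T) (x y : T) (k : nat) :
  has_walk e x y k -> (dist e x y <= k)%N.
Proof.
move=> hk; rewrite leqNgt; apply/negP => lt_k.
have := before_find 0%N lt_k; rewrite nth_iota ?add0n ?hk //.
by apply: leq_trans lt_k _; rewrite -[X in (_ <= X)%N](size_iota 0) find_size.
Qed.

Lemma seq_min_le (disp : Order.disp_t) (R : orderType disp) (x0 x : R)
    (s : seq R) : x \in s -> (seq_min x0 s <= x)%O.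
Proof. by move=> xs; apply: (@ge_bigmin_seq _ _ _ _ _ _ _ id). Qed.

Lemma seq_min_mem (disp : Order.disp_t) (R : orderType disp) (x0 : R)
    (s : seq R) : s != [::] -> seq_min x0 s \in s.
Proof.
case: s => // a s _; rewrite /seq_min big_seq /=.
elim/big_ind: _ => [|x y xs ys|//]; first exact: mem_head.
by rewrite minEle; case: ifP.
Qed.

(* Main.v *)
Require Import Defs.
From mathcomp Require Import all_boot all_order all_algebra.
From mathcomp Require Import zify lra.

(* Let x, y be at distance d, the diameter, let f w = dist x w, and let v be any
   vertex; put a = f v and b = d - a. By the triangle inequality
   dist v w >= |f w - a|. The ends of an edge joining levels s < d and s + 1 have
   disjoint neighbourhoods, both contained in the levels s - 1, ..., s + 2, so
   these four levels contain at least 2 delta vertices. Cutting the levels into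
   blocks of four from level d + 1 downwards, m blocks above level a contribute
   at least 2 delta m (b - 2m) to the sum of the distances from v; likewise, m'
   blocks from level -1 upwards, below level a, contribute 2 delta m' (a - 2m').
   With m an integer nearest to b / 4,
   m (b - 2m) = b^2/8 - (b - 4m)^2/8 >= b^2/8 - 1/2, and
   a^2 + b^2 >= d^2 / 2 then gives the bound. *)

Import Order.TTheory GRing.Theory Num.Theory.
Local Open Scope ring_scope.

Section Distance.
Local Open Scope nat_scope.
Context {T : finType} (e : rel T).

Lemma has_walkP (x y : T) (k : nat) :
  reflect (exists p : seq T, [/\ size p = k, path e x p & last x p = y])
          (has_walk e x y k).
Proof.
apply: (iffP existsP) => [[p /andP[xp /eqP py]]|[p [sp xp py]]].
  by exists p; rewrite size_tuple.
by move/eqP: sp => sp; exists (Tuple sp); rewrite /= xp py eqxx.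
Qed.

Lemma has_walk1 (x y : T) : e x y -> has_walk e x y 1.
Proof. by move=> exy; apply/has_walkP; exists [:: y]; rewrite /= exy. Qed.

Lemma has_walk_cat (x y z : T) (k l : nat) :
  has_walk e x y k -> has_walk e y z l -> has_walk e x z (k + l).
Proof.
move=> /has_walkP[p [<- xp py]] /has_walkP[q [<- yq qz]]; apply/has_walkP.
by exists (p ++ q); rewrite size_cat cat_path last_cat py xp yq.
Qed.

Hypothesis e_conn : connected e.

Lemma dist_triangle (x y z : T) : dist e x z <= dist e x y + dist e y z.
Proof. by apply/dist_min/(has_walk_cat _ y); apply: dist_walk. Qed.

Lemma dist_edge (x u w : T) : e u w -> dist e x w <= (dist e x u).+1.
Proof.
move=> euw; rewrite -addn1; apply/dist_min/(has_walk_cat _ u).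
  exact: dist_walk.
exact: has_walk1.
Qed.

Lemma dist_eq0 (x y : T) : dist e x y = 0 -> x = y.
Proof.
move=> xy0; have := dist_walk (e_conn x y); rewrite xy0.
by case/has_walkP=> p [/size0nil-> _ <-].
Qed.

Lemma dist_pred (x w : T) (s : nat) :
  dist e x w = s.+1 -> exists2 u, e u w & dist e x u = s.
Proof.
move=> xw; have := dist_walk (e_conn x w); rewrite xw.
case/has_walkP=> p; case/lastP: p => [[]//|p w'] [].
rewrite size_rcons rcons_path last_rcons => -[sp] /andP[xp euw] ww'; subst w'.
exists (last x p) => //; apply/eqP; rewrite eqn_leq.
rewrite dist_min; last by apply/has_walkP; exists p.
by have := dist_edge x _ _ euw; rewrite xw ltnS => ->.
Qed.

(** Stepping back from [y] with [dist_pred] descends one level at a time, so it meets every level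
    below that of [y]. *)
Lemma dist_edge_level (x y : T) (s : nat) : s < dist e x y ->
  exists u w, [/\ e u w, dist e x u = s & dist e x w = s.+1].
Proof.
move: {-1}(dist e x y) (erefl (dist e x y)) => k.
elim: k y => // k IHk y xy; rewrite ltnS leq_eqVlt => /predU1P[->|sk].
  by have [u euy xu] := dist_pred _ _ _ xy; exists u, y.
by have [u _ xu] := dist_pred _ _ _ xy; apply: IHk xu sk.
Qed.

Lemma diameter_attained (x0 : T) : exists x y, dist e x y = diameter e.
Proof.
have T0 : 0 < #|T| by apply/card_gt0P; exists x0.
have [x xE] := @bigop.eq_bigmax T (fun x => \max_(y : T) dist e x y) T0.
have [y yE] := @bigop.eq_bigmax T (fun y => dist e x y) T0.
by exists x, y; rewrite /diameter xE yE.
Qed.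

Hypothesis e_sym : symmetric e.

Lemma distC (x y : T) : dist e x y = dist e y x.
Proof.
suff le u v : dist e u v <= dist e v u by apply/eqP; rewrite eqn_leq !le.
have /has_walkP[p [sp vp pu]] := dist_walk (e_conn v u).
apply/dist_min/has_walkP; exists (rev (belast v p)).
rewrite size_rev size_belast; split=> //.
  by rewrite -pu rev_path (eq_path (fun a b => e_sym b a)).
case: p pu {sp vp} => //= a p _.
by rewrite rev_cons last_rcons.
Qed.

(** With truncated subtraction one of the two terms is zero, so their sum is the absolute level
    difference; written this way, it splits into separate sums above and below the level of [v]. *)
Lemma dist_ge_level_gap (x v w : T) :
  (dist e x w - dist e x v) + (dist e x v - dist e x w) <= dist e v w.
Proof.
by have := dist_triangle x v w; have := dist_triangle x w v; rewrite (distC w v); lia.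
Qed.

(** The successor on [dist e x w] expresses levels [s - 1] to [s + 2] without truncation; for
    [s = 0] the window includes the empty level -1. *)
Lemma card_four_levels (delta : nat) (x y : T) (s : nat) :
  triangle_free e -> (forall v, delta <= degree e v) -> s < dist e x y ->
  2 * delta <= #|[pred w | s <= (dist e x w).+1 < s + 4]|.
Proof.
move=> e_tf deg sxy; have [u [w [euw xu xw]]] := dist_edge_level _ _ _ sxy.
have disj : [set z | e u z] :&: [set z | e w z] = set0.
  apply/setP=> z; rewrite !inE; apply/negP=> /andP[euz ewz].
  by have := e_tf u w z; rewrite euw ewz euz.
apply: (@leq_trans #|[set z | e u z] :|: [set z | e w z]|).
  by rewrite cardsU disj cards0 subn0 mul2n -addnn leq_add // deg.
apply/subset_leq_card/subsetP=> z; rewrite !inE => /orP[] ez.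
  have := dist_edge x _ _ ez; have := dist_edge x _ _ (etrans (e_sym z u) ez); lia.
have := dist_edge x _ _ ez; have := dist_edge x _ _ (etrans (e_sym z w) ez); lia.
Qed.

End Distance.

Section LevelSums.
Local Open Scope nat_scope.
Context {T : finType} (f : T -> nat) (D d : nat).
Hypothesis fourD : forall s, s < d -> D <= #|[pred w | s <= (f w).+1 < s + 4]|.

Lemma sum_four_levels (c s : nat) (g : T -> nat) : s < d ->
  (forall w, s <= (f w).+1 < s + 4 -> c <= g w) ->
  D * c <= \sum_(w | s <= (f w).+1 < s + 4) g w.
Proof.
move=> sd cg.
apply: (@leq_trans (\sum_(w | s <= (f w).+1 < s + 4) c)); last exact: leq_sum.
by rewrite sum_nat_const leq_mul2r fourD ?orbT.
Qed.

(* With b = 4 m + c - 1 the topmost block ends at level a + b + 1, and the bound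
   is D m (b - 2 m). *)
Lemma sum_levels_above (a m c : nat) : a + 4 * m + c <= d.+1 ->
  D * (m * (2 * m + c - 1)) <= \sum_(w | f w <= a + 4 * m + c) (f w - a).
Proof.
elim: m => [|m IHm] le_d; first by rewrite mul0n muln0.
rewrite (bigID (fun w => f w <= a + 4 * m + c)) /=.
rewrite (eq_bigl (fun w => f w <= a + 4 * m + c)); last by move=> w; lia.
rewrite [X in _ <= _ + X]
  (eq_bigl (fun w => a + 4 * m + c + 2 <= (f w).+1 < a + 4 * m + c + 2 + 4));
  last by move=> w; lia.
(* The new block starts at level [a + 4 * m + c + 1], which gives the increment. The case [m = 0] is
   separate because [2 * m + c - 1] truncates when [c = 0] as well. *)
have -> : m.+1 * (2 * m.+1 + c - 1) = m * (2 * m + c - 1) + (4 * m + c + 1).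
  case: m {IHm le_d} => [|m]; first by lia.
  have -> : 2 * m.+2 + c - 1 = 2 * m + c + 3 by lia.
  have -> : 2 * m.+1 + c - 1 = 2 * m + c + 1 by lia.
  nia.
rewrite mulnDr leq_add ?IHm //; first by lia.
by apply: sum_four_levels => [|w]; lia.
Qed.

Lemma sum_levels_below (a m : nat) : a <= d -> 4 * m <= a.+1 ->
  D * (m * (a - 2 * m)) <= \sum_(w | (f w).+1 < 4 * m) (a - f w).
Proof.
move=> ad; elim: m => [|m IHm] le_a; first by rewrite mul0n muln0.
rewrite (bigID (fun w => (f w).+1 < 4 * m)) /=.
rewrite (eq_bigl (fun w => (f w).+1 < 4 * m)); last by move=> w; lia.
rewrite [X in _ <= _ + X]
  (eq_bigl (fun w => 4 * m <= (f w).+1 < 4 * m + 4)); last by move=> w; lia.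
(* The new block ends at level [4 * m + 2 < a], so each of its vertices contributes at least
   [a - 4 * m - 2]. *)
have -> : m.+1 * (a - 2 * m.+1) = m * (a - 2 * m) + (a - 4 * m - 2).
  have -> : a - 4 * m - 2 = a - 2 * m.+1 - 2 * m by lia.
  have -> : a - 2 * m = a - 2 * m.+1 + 2 by lia.
  have : 2 * m <= a - 2 * m.+1 by lia.
  move: (a - 2 * m.+1) => k k_ge; nia.
rewrite mulnDr leq_add ?IHm //; first by lia.
by apply: sum_four_levels => [|w]; lia.
Qed.

End LevelSums.

(** The quotient [b.+1 %/ 4] is an integer [m] nearest to b/4, so [(b - 4m)^2 <= 4]; the estimate is
    scaled by 16 to stay in the naturals. *)
Lemma nearest_quarter_bound (b : nat) :
  (2 * b ^ 2 <= 16 * ((b.+1 %/ 4) * (b - 2 * (b.+1 %/ 4))) + 8)%N.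
Proof.
have := divn_eq b.+1 4; have : (b.+1 %% 4 < 4)%N by rewrite ltn_mod.
move: (b.+1 %/ 4)%N (b.+1 %% 4)%N => q r r4 bE.
case: q bE => [|q] bE; first by nia.
have -> : b = (4 * q + r + 3)%N by lia.
have -> : (4 * q + r + 3 - 2 * q.+1 = 2 * q + r + 1)%N by lia.
by case: r r4 {bE} => [|[|[|[|r]]]] //= _; nia.
Qed.

Lemma sum_dist_lower_bound {T : finType} (e : rel T) (delta : nat) (x y v : T) :
  connected e -> symmetric e -> triangle_free e ->
  (forall w, delta <= degree e w)%N -> (dist e x v <= dist e x y)%N ->
  (delta * dist e x y ^ 2 <= 8 * (\sum_w dist e v w) + 16 * delta)%N.
Proof.
move=> e_conn e_sym e_tf deg.
set d := dist e x y; set a := dist e x v; set S := (\sum_w _)%N => ad.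
have four s := @card_four_levels T e e_conn e_sym delta x y s e_tf deg.
have gaps : (\sum_w (dist e x w - a) + \sum_w (a - dist e x w) <= S)%N.
  by rewrite -big_split leq_sum // => w _; apply: dist_ge_level_gap.
have sum_pred (P : pred T) g : (\sum_(w | P w) g w <= \sum_w g w)%N.
  by rewrite [leqRHS](bigID P) leq_addr.
have below : (2 * delta * (a.+1 %/ 4 * (a - 2 * (a.+1 %/ 4)))
              <= \sum_w (a - dist e x w))%N.
  apply: leq_trans (sum_pred _ _).
  by apply: (sum_levels_below (dist e x) _ d) => //; rewrite mulnC leq_divM.
set b := (d - a)%N.
have above : (2 * delta * (b.+1 %/ 4 * (b - 2 * (b.+1 %/ 4)))
              <= \sum_w (dist e x w - a))%N.
  apply: leq_trans (sum_pred
    (fun w => dist e x w <= a + 4 * (b.+1 %/ 4) + b.+1 %% 4)%N _).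
  (* Taking [c = b.+1 %% 4] makes the topmost block end exactly at level [d + 1], and
     [2 * m + c - 1] becomes [b - 2 * m]. *)
  apply: leq_trans (sum_levels_above (dist e x) _ d four _ _ _ _); last first.
    by have := divn_eq b.+1 4; lia.
  by rewrite leq_mul2l leq_mul2l; have := divn_eq b.+1 4; lia.
have dE : d = (a + b)%N by rewrite subnKC.
have d2 : (d ^ 2 <= 2 * a ^ 2 + 2 * b ^ 2)%N.
  by rewrite dE sqrnD; have := (nat_Cauchy a b).1; lia.
have := nearest_quarter_bound b; have := nearest_quarter_bound a.
move: (_ * (a - _))%N (_ * (b - _))%N below above => p q below above ha hb.
have : (delta * d ^ 2 <= delta * (16 * (p + q) + 16))%N by rewrite leq_mul2l; lia.
by rewrite !mulnDr; lia.
Qed.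

Theorem theorem4p2 (n delta d : nat) (T : finType) (e : rel T) :
  (3 <= delta)%N -> (8 <= n)%N ->
  symmetric e -> irreflexive e ->
  connected e -> triangle_free e ->
  #|T| = n -> min_degree e = delta -> diameter e = d ->
  delta%:R * (d%:R - 4) * (d%:R - 1) / (8 * (n%:R - 1)) <= proximity e.
Proof.
move=> delta3 n8 e_sym e_irr e_conn e_tf Tn deltaE dE.
have deg w : (delta <= degree e w)%N.
  by rewrite -deltaE -leEnat; apply: seq_min_le; apply: image_f.
have /card_gt0P[x0 _] : (0 < #|T|)%N by rewrite Tn; lia.
have [v ->] : exists v, proximity e = avg_dist e v.
  have /seq_min_mem : [seq avg_dist e v | v : T] != [::].
    by rewrite -size_eq0 size_map -cardE Tn; lia.
  by move=> /(_ 0)/imageP[v _ vE]; exists v.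
have dist_le_d u w : (dist e u w <= d)%N.
  rewrite -dE; apply: leq_trans (bigop.leq_bigmax u).
  exact: (bigop.leq_bigmax (F := fun w => dist e u w)).
(* Positivity of [d] gives [d - 1] its sign in the case [d <= 4], where the claimed bound is
   nonpositive. *)
have d_gt0 : (0 < d)%N.
  have /card_gt0P[w] : (0 < degree e x0)%N by apply: leq_trans (deg x0); lia.
  rewrite inE => x0w; apply: leq_trans (dist_le_d x0 w); rewrite lt0n.
  by apply/eqP=> /(dist_eq0 _ e_conn) x0E; rewrite -x0E e_irr in x0w.
have [x [y xyd]] := diameter_attained e x0; rewrite dE in xyd.
have := sum_dist_lower_bound e delta x y v e_conn e_sym e_tf deg.
rewrite xyd => /(_ (dist_le_d x v)).
rewrite /avg_dist -natr_sum Tn; move: (\sum_w _)%N => S dS.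
have n1 : 0 < n%:R - 1 :> rat by rewrite subr_gt0 ltr1n; lia.
rewrite invfM mulrA ler_pM2r ?invr_gt0 // ler_pdivrMr //.
have [d4|d4] := leqP d 4.
  apply: (@le_trans _ _ 0); last by rewrite mulr_ge0.
  rewrite -mulrA mulr_ge0_le0 // mulr_le0_ge0 ?subr_le0 ?subr_ge0 ?ler_nat //.
  by rewrite ler1n.
(* The error term [16 * delta] is absorbed because [d^2 - 16 = (d - 4)(d + 4)] is at least
   [(d - 4)(d - 1)] for [d >= 4]. *)
move: dS; rewrite -(ler_nat rat) natrD !natrM => dS.
have d4' : 4 <= d%:R :> rat by rewrite ler_nat ltnW.
have delta0 : 0 <= delta%:R :> rat by [].
nra.
Qed.
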